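(* Let $k$ be a field, let $A$ and $B$ be finite-dimensional $k$-algebras, let $X$ be a nonzero finitely generated left $A$-module and $Y$ a nonzero finitely generated left $B$-module. Write $\otimes=\otimes_k$. Then: (1) $X\otimes Y$ is a torsionless $(A\otimes B)$-module if and only if $X$ is a torsionless $A$-module and $Y$ is a torsionless $B$-module. (2) $X\otimes Y$ is a reflexive $(A\otimes B)$-module if and only if $X$ is a reflexive $A$-module and $Y$ is a reflexive $B$-module.
   Context: For a module $M$ over a ring $R$ put $M^*=\operatorname{Hom}_R(M,R)$ and let $\phi_M:M\to M^{**}$ be the canonical homomorphism $\phi_M(m)(f)=f(m)$ for $m\in M$, $f\in M^*$. The module $M$ is torsionless if $\phi_M$ is injective and reflexive if $\phi_M$ is bijective. $X\otimes Y$ is a left $(A\otimes B)$-module via $(a\otimes b)(x\otimes y)=ax\otimes by$. *)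

(* Defs.v *)
From HB Require Import structures.
From mathcomp Require Import all_boot all_algebra falgebra.
From mathcomp Require Import finmap monalg boolp functions.

Set Implicit Arguments.
Unset Strict Implicit.
Unset Printing Implicit Defensive.

Import GRing.Theory.
Local Open Scope ring_scope.
Local Open Scope quotient_scope.

Definition finitely_generated (R : pzRingType) (M : lmodType R) : Prop :=
  exists s : seq M, forall x : M,
    exists c : 'I_(size s) -> R, x = \sum_(i < size s) c i *: s`_i.

(* The dual of a left R-module M is a right R-module through
   (f r)(m) = f(m) r, that is, a left module over the opposite ring R^c.
   Hence dual (dual M) consists of the maps g : dual M -> R such that
   g (f r) = g(f) r, and it is again a left R-module (R^c^c = R). *)
Section Dual.
Variables (R : pzRingType) (M : lmodType R).

Definition dual := {linear M -> R^o}.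

HB.instance Definition _ := gen_eqMixin dual.
HB.instance Definition _ := gen_choiceMixin dual.

Lemma dualP (f g : dual) : (forall m, f m = g m) -> f = g.
Proof.
case: f g => f [[[[fN fD]] [fS]]]; case=> g [[[[gN gD]] [gS]]] /= /funext E.
move: fN fD fS gN gD gS; rewrite E => fN fD fS gN gD gS.
by congr (GRing.Linear.Pack (GRing.Linear.Class _ _));
   rewrite ?(Prop_irrelevance fN gN) ?(Prop_irrelevance fD gD)
           ?(Prop_irrelevance fS gS).
Qed.

Definition mk_dual (f : M -> R^o) (fL : linear f) : dual :=
  HB.pack f (GRing.isLinear.Build R M R^o _ f fL).

Lemma dual_zero_linear : linear (fun _ : M => 0 : R^o).
Proof. by move=> a x y; rewrite scaler0 addr0. Qed.

Lemma dual_add_linear (f g : dual) : linear (fun m => f m + g m : R^o).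
Proof. by move=> a x y; rewrite !linearP scalerDr addrACA. Qed.

Lemma dual_opp_linear (f : dual) : linear (fun m => - f m : R^o).
Proof. by move=> a x y; rewrite linearP opprD scalerN. Qed.

Lemma dual_scale_linear (r : R) (f : dual) :
  linear (fun m => (f m : R) * r : R^o).
Proof. by move=> a x y; rewrite linearP mulrDl /GRing.scale /= mulrA. Qed.

Definition dual_zero := mk_dual dual_zero_linear.
Definition dual_add f g := mk_dual (dual_add_linear f g).
Definition dual_opp f := mk_dual (dual_opp_linear f).
Definition dual_scale (r : R^c) f := mk_dual (dual_scale_linear r f).

Lemma dual_addA : associative dual_add.
Proof. by move=> f g h; apply: dualP => m /=; rewrite addrA. Qed.
Lemma dual_addC : commutative dual_add.
Proof. by move=> f g; apply: dualP => m /=; rewrite addrC. Qed.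
Lemma dual_add0 : left_id dual_zero dual_add.
Proof. by move=> f; apply: dualP => m /=; rewrite add0r. Qed.
Lemma dual_addN : left_inverse dual_zero dual_opp dual_add.
Proof. by move=> f; apply: dualP => m /=; rewrite addNr. Qed.

HB.instance Definition _ :=
  GRing.isZmodule.Build dual dual_addA dual_addC dual_add0 dual_addN.

Lemma dual_scaleA (a b : R^c) f :
  dual_scale a (dual_scale b f) = dual_scale (a * b) f.
Proof. by apply: dualP => m /=; rewrite -mulrA. Qed.
Lemma dual_scale1 : left_id 1 dual_scale.
Proof. by move=> f; apply: dualP => m /=; rewrite mulr1. Qed.
Lemma dual_scaleDr : right_distributive dual_scale +%R.
Proof. by move=> a f g; apply: dualP => m /=; rewrite mulrDl. Qed.
Lemma dual_scaleDl f : {morph dual_scale^~ f : a b / a + b}.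
Proof. by move=> a b; apply: dualP => m /=; rewrite mulrDr. Qed.

HB.instance Definition _ := GRing.Zmodule_isLmodule.Build R^c dual
  dual_scaleA dual_scale1 dual_scaleDr dual_scaleDl.

End Dual.

Section Bidual.
Variables (R : pzRingType) (M : lmodType R).

Lemma bidual_map_linear (m : M) :
  linear (fun f : dual M => (f : {linear M -> R^o}) m : R^c^o).
Proof. by []. Qed.

(* The canonical homomorphism phi_M : M -> M^**, phi_M(m)(f) = f(m). *)
Definition bidual_map (m : M) : dual (dual M) :=
  mk_dual (bidual_map_linear m).

Lemma bidual_mapE m (f : dual M) : bidual_map m f = f m.
Proof. by []. Qed.

Definition torsionless : Prop := injective bidual_map.
Definition reflexive_module : Prop := bijective bidual_map.

End Bidual.

Arguments torsionless {R} M.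
Arguments reflexive_module {R} M.

Section Tensor.
Variables (k : fieldType) (U V : lmodType k).

Local Notation free := {malg k[(U * V)%type]}.
Local Notation gen u v := (<< (u, v) >> : free).

(* The tensor product is the free k-module on U * V modulo the submodule
   generated by the bilinearity relations. *)
Inductive tensor_rel : free -> Prop :=
| TensorAddl u u' v : tensor_rel (gen (u + u') v - (gen u v + gen u' v))
| TensorAddr u v v' : tensor_rel (gen u (v + v') - (gen u v + gen u v'))
| TensorScalel c u v : tensor_rel (gen (c *: u) v - c *: gen u v)
| TensorScaler c u v : tensor_rel (gen u (c *: v) - c *: gen u v)
| TensorRel0 : tensor_rel 0
| TensorRelD x y : tensor_rel x -> tensor_rel y -> tensor_rel (x + y)
| TensorRelZ c x : tensor_rel x -> tensor_rel (c *: x).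

Definition tensor_relb (x : free) : bool := `[< tensor_rel x >].

Lemma tensor_relb_zmod : zmod_closed tensor_relb.
Proof.
split=> [|x y /asboolP rx /asboolP ry]; apply/asboolP; first exact: TensorRel0.
by apply: TensorRelD rx _; rewrite -scaleN1r; apply: TensorRelZ.
Qed.

HB.instance Definition _ :=
  GRing.isZmodClosed.Build free tensor_relb tensor_relb_zmod.

Local Notation quo :=
  (Quotient.quot (GRing.ZmodClosed.clone free tensor_relb _)).

Definition tensor : Type := quo.

HB.instance Definition _ := GRing.Zmodule.on tensor.

Definition tensor_pi (x : free) : tensor := \pi_quo x.
Definition tensor_repr (t : tensor) : free := repr (t : quo).

Lemma tensor_reprK : cancel tensor_repr tensor_pi.
Proof. by move=> t; exact: (@reprK _ quo t). Qed.

Lemma tensor_piP x y : tensor_rel (x - y) <-> tensor_pi x = tensor_pi y.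
Proof.
split=> [r|/eqP]; first by apply/eqP; rewrite -Quotient.idealrBE; apply/asboolP.
by rewrite -Quotient.idealrBE => /asboolP.
Qed.

Lemma tensor_piD : {morph tensor_pi : x y / x + y}.
Proof. exact: (raddfD (\pi_quo)). Qed.

Definition tensor_scale c (t : tensor) : tensor := tensor_pi (c *: tensor_repr t).

Lemma tensor_piZ c x : tensor_scale c (tensor_pi x) = tensor_pi (c *: x).
Proof.
apply/tensor_piP; rewrite -scalerBr; apply: TensorRelZ; apply/tensor_piP.
exact: tensor_reprK.
Qed.

Lemma tensor_scaleA a b t :
  tensor_scale a (tensor_scale b t) = tensor_scale (a * b) t.
Proof. by rewrite -[t]tensor_reprK !tensor_piZ scalerA. Qed.
Lemma tensor_scale1 : left_id 1 tensor_scale.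
Proof. by move=> t; rewrite -[t]tensor_reprK !tensor_piZ scale1r. Qed.
Lemma tensor_scaleDr : right_distributive tensor_scale +%R.
Proof.
move=> a s t; rewrite -[s]tensor_reprK -[t]tensor_reprK.
by rewrite -tensor_piD !tensor_piZ -tensor_piD scalerDr.
Qed.
Lemma tensor_scaleDl t : {morph tensor_scale^~ t : a b / a + b}.
Proof.
by move=> a b; rewrite -[t]tensor_reprK !tensor_piZ -tensor_piD scalerDl.
Qed.

HB.instance Definition _ := GRing.Zmodule_isLmodule.Build k tensor
  tensor_scaleA tensor_scale1 tensor_scaleDr tensor_scaleDl.

Lemma tensor_pi_linear : linear tensor_pi.
Proof. by move=> c x y; rewrite tensor_piD -tensor_piZ. Qed.

HB.instance Definition _ :=
  GRing.isLinear.Build k free tensor _ tensor_pi tensor_pi_linear.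

Definition tens (u : U) (v : V) : tensor := tensor_pi (gen u v).

Lemma tens_bilinear : bilinear_for *:%R *:%R tens.
Proof.
split=> [v c u u'|u c v v']; rewrite /tens -linearZ -linearD.
- transitivity (tensor_pi (gen (c *: u) v + gen u' v)).
    by apply/tensor_piP; apply: TensorAddl.
  by apply/tensor_piP; rewrite opprD addrACA subrr addr0; apply: TensorScalel.
- transitivity (tensor_pi (gen u (c *: v) + gen u v')).
    by apply/tensor_piP; apply: TensorAddr.
  by apply/tensor_piP; rewrite opprD addrACA subrr addr0; apply: TensorScaler.
Qed.

Lemma tensor_ind (P : tensor -> Prop) :
    (forall u v, P (tens u v)) ->
    (forall c s t, P s -> P t -> P (c *: s + t)) ->
  forall t, P t.
Proof.
move=> Ptens PD t.
have P0 : P 0 by have := PD (-1) _ _ (Ptens 0 0) (Ptens 0 0);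
  rewrite scaleN1r addNr.
rewrite -[t]tensor_reprK [tensor_repr t]monalgE linear_sum /=.
elim/big_rec: _ => // -[u v] s _ Ps.
suff -> : << (tensor_repr t)@_(u, v) *g (u, v) >>
        = (tensor_repr t)@_(u, v) *: gen u v.
  by rewrite linearZ; apply: PD (Ptens u v) Ps.
by apply/malgP => x; rewrite mcoeffZ !mcoeffU mulr_natr.
Qed.

Section Lift.
Variable W : lmodType k.

Definition free_lift (f : U -> V -> W) (x : free) : W :=
  \sum_(p <- msupp x) x@_p *: f p.1 p.2.

Lemma free_liftw f (d : {fset (U * V)%type}) x : (msupp x `<=` d)%fset ->
  free_lift f x = \sum_(p <- d) x@_p *: f p.1 p.2.
Proof.
move=> xd; apply: big_fset_incl => // p _ px.
by rewrite (mcoeff_outdom px) scale0r.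
Qed.

Lemma free_lift_linear f : linear (free_lift f).
Proof.
move=> c x y; set d := (msupp x `|` msupp y `|` msupp (c *: x + y))%fset.
have xd : (msupp x `<=` d)%fset.
  by apply/fsubsetP => p px; rewrite !in_fsetU px.
have yd : (msupp y `<=` d)%fset.
  by apply/fsubsetP => p px; rewrite !in_fsetU px orbT.
have zd : (msupp (c *: x + y) `<=` d)%fset.
  by apply/fsubsetP => p px; rewrite !in_fsetU px orbT.
rewrite (free_liftw f xd) (free_liftw f yd) (free_liftw f zd).
rewrite scaler_sumr -big_split; apply: eq_bigr => p _ /=.
by rewrite mcoeffD mcoeffZ scalerDl scalerA.
Qed.

HB.instance Definition _ f :=
  GRing.isLinear.Build k free W _ (free_lift f) (free_lift_linear f).

Lemma free_liftU f u v : free_lift f (gen u v) = f u v.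
Proof.
by rewrite (free_liftw f (msuppU_le)) big_seq_fset1 mcoeffUU scale1r.
Qed.

Definition tensor_lift (f : U -> V -> W) (t : tensor) : W :=
  free_lift f (tensor_repr t).

Lemma tensor_lift_pi f x : bilinear_for *:%R *:%R f ->
  tensor_lift f (tensor_pi x) = free_lift f x.
Proof.
move=> [fl fr]; apply/eqP; rewrite -subr_eq0 -linearB; apply/eqP.
have : tensor_rel (tensor_repr (tensor_pi x) - x).
  by apply/tensor_piP; rewrite tensor_reprK.
elim=> [u u' v|u v v'|c u v|c u v||a b _ a0 _ b0|c a _ a0].
- have := fl v 1 u u'; rewrite /= !scale1r linearB linearD /= !free_liftU => ->.
  exact: subrr.
- have := fr u 1 v v'; rewrite /= !scale1r linearB linearD /= !free_liftU => ->.
  exact: subrr.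
- have f0 : f 0 v = 0.
    by have /= := fl v (-1) 0 0; rewrite scaler0 addr0 scaleN1r addNr.
  have /= := fl v c u 0; rewrite linearB linearZ /= !free_liftU f0 !addr0 => ->.
  exact: subrr.
- have f0 : f u 0 = 0.
    by have /= := fr u (-1) 0 0; rewrite scaler0 addr0 scaleN1r addNr.
  have /= := fr u c v 0; rewrite linearB linearZ /= !free_liftU f0 !addr0 => ->.
  exact: subrr.
- exact: linear0.
- by rewrite linearD a0 b0 addr0.
- by rewrite linearZ a0 /= scaler0.
Qed.

Lemma tensor_lift_linear f : bilinear_for *:%R *:%R f -> linear (tensor_lift f).
Proof.
move=> fB c s t; rewrite -[s]tensor_reprK -[t]tensor_reprK.
by rewrite -linearZ -linearD !tensor_lift_pi // linearP.
Qed.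

Lemma tensor_liftE f u v : bilinear_for *:%R *:%R f ->
  tensor_lift f (tens u v) = f u v.
Proof. by move=> fB; rewrite tensor_lift_pi // free_liftU. Qed.

Lemma tensor_liftP c f g t :
  tensor_lift (fun u v => c *: f u v + g u v) t
    = c *: tensor_lift f t + tensor_lift g t.
Proof.
rewrite scaler_sumr -big_split; apply: eq_bigr => p _ /=.
by rewrite scalerDr !scalerA mulrC.
Qed.

End Lift.
End Tensor.

(* For bilinear m and n, the bilinear map sending (u1 (x) v1, u2 (x) v2)
   to m u1 u2 (x) n v1 v2. *)
Section TensorMap2.
Variables (k : fieldType) (U1 U2 U3 V1 V2 V3 : lmodType k).
Variables (m : U1 -> U2 -> U3) (n : V1 -> V2 -> V3).
Hypothesis (mB : bilinear_for *:%R *:%R m) (nB : bilinear_for *:%R *:%R n).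

Definition tensor_map2 (s : tensor U1 V1) (t : tensor U2 V2) : tensor U3 V3 :=
  tensor_lift (fun u1 v1 => tensor_lift (fun u2 v2 =>
    tens (m u1 u2) (n v1 v2)) : tensor U2 V2 -> tensor U3 V3) s t.

Let inner_bilinear u1 v1 :
  bilinear_for *:%R *:%R (fun u2 v2 => tens (m u1 u2) (n v1 v2)).
Proof.
by split=> [v c u u'|u c v v'];
   rewrite ?mB.2 ?nB.2 ?(tens_bilinear _ _).1 ?(tens_bilinear _ _).2.
Qed.

Let outer_bilinear : bilinear_for *:%R *:%R
  (fun u1 v1 => tensor_lift (fun u2 v2 =>
    tens (m u1 u2) (n v1 v2)) : tensor U2 V2 -> tensor U3 V3).
Proof.
split=> [v c u u'|u c v v']; apply: funext => t;
  rewrite /= -[RHS]tensor_liftP; congr (tensor_lift _ t);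
  apply: funext => a; apply: funext => b;
  by rewrite ?mB.1 ?nB.1 ?(tens_bilinear _ _).1 ?(tens_bilinear _ _).2.
Qed.

Lemma tensor_map2E u1 v1 u2 v2 :
  tensor_map2 (tens u1 v1) (tens u2 v2) = tens (m u1 u2) (n v1 v2).
Proof. by rewrite /tensor_map2 tensor_liftE // tensor_liftE. Qed.

Lemma tensor_map2_bilinear : bilinear_for *:%R *:%R tensor_map2.
Proof.
split=> [t c s s'|s]; first by rewrite /tensor_map2 tensor_lift_linear.
elim/tensor_ind: s => [u v|d s s' IHs IHs'] c t t'.
  by rewrite /tensor_map2 tensor_liftE // tensor_lift_linear.
have E r : tensor_map2 (d *: s + s') r
         = d *: tensor_map2 s r + tensor_map2 s' r.
  by rewrite /tensor_map2 tensor_lift_linear.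
rewrite !E IHs IHs' /= !scalerDr !scalerA mulrC.
exact: addrACA.
Qed.

End TensorMap2.

Section RestrictScalars.
Variables (k : fieldType) (A : algType k) (X : lmodType A).

(* X seen as a k-module through the structure map c |-> c%:A of A *)
Definition restrict_scalars : Type := X.

HB.instance Definition _ := GRing.Zmodule.on restrict_scalars.

Definition restricted_scale (c : k) (x : restrict_scalars) : restrict_scalars :=
  (c%:A : A) *: (x : X).

Lemma restricted_scaleA a b x :
  restricted_scale a (restricted_scale b x) = restricted_scale (a * b) x.
Proof. by rewrite /restricted_scale scalerA -scalerAl mul1r scalerA. Qed.
Lemma restricted_scale1 : left_id 1 restricted_scale.
Proof. by move=> x; rewrite /restricted_scale !scale1r. Qed.
Lemma restricted_scaleDr : right_distributive restricted_scale +%R.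
Proof. by move=> a x y; rewrite /restricted_scale scalerDr. Qed.
Lemma restricted_scaleDl x : {morph restricted_scale^~ x : a b / a + b}.
Proof. by move=> a b; rewrite /restricted_scale !scalerDl. Qed.

HB.instance Definition _ := GRing.Zmodule_isLmodule.Build k restrict_scalars
  restricted_scaleA restricted_scale1 restricted_scaleDr restricted_scaleDl.

Definition algebra_act (a : A) (x : restrict_scalars) : restrict_scalars :=
  a *: (x : X).

Lemma algebra_act_bilinear : bilinear_for *:%R *:%R algebra_act.
Proof.
split=> [x c a a'|a c x x'].
  rewrite /algebra_act scalerDl; congr (_ + _).
  by rewrite [RHS]scalerA -scalerAl mul1r.
rewrite /algebra_act scalerDr; congr (_ + _).
by rewrite [LHS]scalerA [RHS]scalerA -scalerAl -scalerAr mul1r mulr1.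
Qed.

End RestrictScalars.

(* (a (x) b) (a' (x) b') = (a a') (x) (b b'); see tensor_alg_mulE. *)
Section TensorAlgebra.
Variables (k : fieldType) (A B : algType k).

Lemma algebra_mul_bilinear (C : algType k) :
  bilinear_for *:%R *:%R ( *%R : C -> C -> C).
Proof.
split=> [x c a a'|a c x x'] /=; first by rewrite mulrDl scalerAl.
by rewrite mulrDr scalerAr.
Qed.

Definition tensor_alg : Type := tensor A B.

HB.instance Definition _ := GRing.Lmodule.on tensor_alg.

Definition tensor_alg_one : tensor_alg := tens (1 : A) (1 : B).
Definition tensor_alg_mul : tensor_alg -> tensor_alg -> tensor_alg :=
  tensor_map2 ( *%R : A -> A -> A) ( *%R : B -> B -> B).

Let mulB : bilinear_for *:%R *:%R tensor_alg_mul.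
Proof. by apply: tensor_map2_bilinear; apply: algebra_mul_bilinear. Qed.

Lemma tensor_alg_mulE a b a' b' :
  tensor_alg_mul (tens a b) (tens a' b') = tens (a * a') (b * b').
Proof. by apply: tensor_map2E; apply: algebra_mul_bilinear. Qed.

Lemma tensor_alg_mulA : associative tensor_alg_mul.
Proof.
move=> x y z; elim/tensor_ind: x => [a b|c x x' IHx IHx'].
  elim/tensor_ind: y => [a' b'|c y y' IHy IHy'].
    elim/tensor_ind: z => [a'' b''|c z z' IHz IHz'].
      by rewrite !tensor_alg_mulE !mulrA.
    by rewrite !mulB.2 IHz IHz'.
  by rewrite mulB.1 !mulB.2 mulB.1 IHy IHy'.
by rewrite !mulB.1 IHx IHx'.
Qed.

Lemma tensor_alg_mul1l : left_id tensor_alg_one tensor_alg_mul.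
Proof.
elim/tensor_ind=> [a b|c x y IHx IHy].
  by rewrite tensor_alg_mulE !mul1r.
by rewrite mulB.2 IHx IHy.
Qed.

Lemma tensor_alg_mul1r : right_id tensor_alg_one tensor_alg_mul.
Proof.
elim/tensor_ind=> [a b|c x y IHx IHy].
  by rewrite tensor_alg_mulE !mulr1.
by rewrite mulB.1 IHx IHy.
Qed.

Lemma tensor_alg_mulDl : left_distributive tensor_alg_mul +%R.
Proof. by move=> x y z; have := mulB.1 z 1 x y; rewrite /= !scale1r. Qed.

Lemma tensor_alg_mulDr : right_distributive tensor_alg_mul +%R.
Proof. by move=> x y z; have := mulB.2 x 1 y z; rewrite /= !scale1r. Qed.

HB.instance Definition _ := GRing.Zmodule_isPzRing.Build tensor_alg
  tensor_alg_mulA tensor_alg_mul1l tensor_alg_mul1r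
  tensor_alg_mulDl tensor_alg_mulDr.

End TensorAlgebra.

(* (a (x) b) (x (x) y) = (a x) (x) (b y); see tensor_mod_scaleE. *)
Section TensorModule.
Variables (k : fieldType) (A B : algType k).
Variables (X : lmodType A) (Y : lmodType B).

Definition tensor_mod : Type :=
  tensor (restrict_scalars X) (restrict_scalars Y).

HB.instance Definition _ := GRing.Zmodule.on tensor_mod.

Definition tensor_mod_scale : tensor_alg A B -> tensor_mod -> tensor_mod :=
  tensor_map2 (@algebra_act k A X) (@algebra_act k B Y).

Let scaleB : bilinear_for *:%R *:%R
  (tensor_mod_scale : tensor A B -> tensor _ _ -> tensor _ _).
Proof. by apply: tensor_map2_bilinear; apply: algebra_act_bilinear. Qed.

Lemma tensor_mod_scaleE (a : A) (b : B) (x : X) (y : Y) :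
  tensor_mod_scale (tens a b)
    (tens (x : restrict_scalars X) (y : restrict_scalars Y))
  = tens (a *: x : restrict_scalars X) (b *: y : restrict_scalars Y).
Proof. by apply: tensor_map2E; apply: algebra_act_bilinear. Qed.

Lemma tensor_mod_scaleA (s t : tensor_alg A B) (z : tensor_mod) :
  tensor_mod_scale s (tensor_mod_scale t z) = tensor_mod_scale (s * t) z.
Proof.
rewrite -[s * t]/(tensor_alg_mul s t).
have mulB : bilinear_for *:%R *:%R (@tensor_alg_mul k A B).
  by apply: tensor_map2_bilinear; apply: algebra_mul_bilinear.
elim/tensor_ind: s => [a b|c s s' IHs IHs'].
  elim/tensor_ind: t => [a' b'|c t t' IHt IHt'].
    elim/tensor_ind: z => [x y|c z z' IHz IHz'].
      by rewrite tensor_alg_mulE !tensor_mod_scaleE !scalerA.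
    by rewrite !scaleB.2 IHz IHz'.
  by rewrite scaleB.1 scaleB.2 IHt IHt' mulB.2 [RHS]scaleB.1.
by rewrite scaleB.1 IHs IHs' mulB.1 [RHS]scaleB.1.
Qed.

Lemma tensor_mod_scale1 : left_id 1 tensor_mod_scale.
Proof.
elim/tensor_ind=> [x y|c z z' IHz IHz'].
  by rewrite tensor_mod_scaleE !scale1r.
by rewrite scaleB.2 IHz IHz'.
Qed.

Lemma tensor_mod_scaleDr : right_distributive tensor_mod_scale +%R.
Proof. by move=> t x y; have := scaleB.2 t 1 x y; rewrite /= !scale1r. Qed.

Lemma tensor_mod_scaleDl z : {morph tensor_mod_scale^~ z : s t / s + t}.
Proof. by move=> s t; have := scaleB.1 z 1 s t; rewrite /= !scale1r. Qed.

HB.instance Definition _ :=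
  GRing.Zmodule_isLmodule.Build (tensor_alg A B) tensor_mod
    tensor_mod_scaleA tensor_mod_scale1 tensor_mod_scaleDr tensor_mod_scaleDl.

End TensorModule.

(* Main.v *)
(* Elements of X (x) Y and maps into A (x) B are tested by slicing: a linear
   form l on B gives id (x) l : A (x) B -> A, and these maps jointly separate
   points. Slicing turns a dual element F of X (x) Y into the dual elements
   x |-> (id (x) l)(F (x (x) y)) of X. Writing F = sum f_i (x) g_i with
   A-linear f_i that are linearly independent over k forces the g_i to be
   B-linear, so the dual of X (x) Y is spanned by pure tensors f (x) g; the same
   argument splits f, g |-> G (f (x) g) for G in the bidual when X and Y are
   reflexive. Conversely phi in X^** extends to phi (x) ev_y in the bidual of
   X (x) Y, and if this is evaluation at z, then phi is evaluation at a multiple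
   of (id (x) l g)(z), where l (g y) <> 0. The factor Y is handled by the swap
   isomorphism between X (x) Y and Y (x) X. *)
From HB Require Import structures.
Require Import Defs.
From mathcomp Require Import all_boot all_algebra falgebra.
From mathcomp Require Import boolp functions.

Set Implicit Arguments.
Unset Strict Implicit.
Unset Printing Implicit Defensive.

Import GRing.Theory.
Local Open Scope ring_scope.

(** * Linear algebra over k: independent subfamilies and separating forms *)

Section LinearAlgebra.
Variable k : fieldType.

Definition spans_family (V : lmodType k) (I : finType) (e : I -> V) : Prop :=
  forall v, exists c : I -> k, v = \sum_i c i *: e i.

Lemma free_subfamily (I : finType) (V : lmodType k) (e : I -> V) :
  exists J : {set I},
    (forall i, exists c : I -> k, e i = \sum_(j in J) c j *: e j) /\
    (forall c : I -> k, \sum_(j in J) c j *: e j = 0 ->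
       forall j, j \in J -> c j = 0).
Proof.
pose spanning (J : {set I}) := `[< forall i, exists c : I -> k,
  e i = \sum_(j in J) c j *: e j >].
have spanT : exists J, spanning J.
  exists setT; apply/asboolP => i; exists (fun j => (j == i)%:R).
  rewrite (bigD1 i) ?inE //= eqxx scale1r big1 ?addr0 // => j /andP[_ ji].
  by rewrite (negPf ji) scale0r.
have [J /minsetP [/asboolP spanJ minJ]] := ex_minset spanT.
exists J; split=> // c c0 j jJ; apply: contrapT => cj0.
suff /minJ/(_ (subD1set J j)) E : spanning (J :\ j).
  by have := setD11 j J; rewrite E jJ.
have ej : e j = \sum_(i in J :\ j) (- (c j)^-1 * c i) *: e i.
  move: c0; rewrite (big_setD1 j) //= => /eqP.
  rewrite addr_eq0 => /eqP E.
  have -> : e j = (c j)^-1 *: (c j *: e j).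
    by rewrite scalerA mulVf ?scale1r //; apply/eqP.
  rewrite E scalerN -scaleNr scaler_sumr.
  by apply: eq_bigr => i _; rewrite scalerA.
apply/asboolP => i; have [d ->] := spanJ i.
(* Substitute [ej] into the expansion of [e i] over [J], which eliminates [e j]. *)
exists (fun l => d j * (- (c j)^-1 * c l) + d l).
rewrite (big_setD1 j) //= ej scaler_sumr -big_split /=.
by apply: eq_bigr => l _; rewrite scalerDl scalerA.
Qed.

(** The form is a coordinate with respect to an independent subfamily that still spans; some
    coordinate of [v] is nonzero. *)
Lemma linear_form_neq0 (V : lmodType k) (I : finType) (e : I -> V) (v : V) :
  spans_family e -> v <> 0 -> exists l : {linear V -> k^o}, l v <> 0.
Proof.
move=> spe v0; have [J [spanJ indJ]] := free_subfamily e.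
have /choice[d dE] i := spanJ i.
have /choice[c cE] u : exists c : I -> k, u = \sum_(j in J) c j *: e j.
  have [a ->] := spe u; exists (fun j => \sum_i a i * d i j).
  rewrite (eq_bigr _ (fun i _ => congr1 (fun w => a i *: w) (dE i))).
  under eq_bigr do rewrite scaler_sumr.
  rewrite exchange_big /=; apply: eq_bigr => j _; rewrite scaler_suml.
  by apply: eq_bigr => i _; rewrite scalerA.
have [j [jJ cj0]] : exists j, j \in J /\ c v j <> 0.
  apply: contrapT => H; apply: v0; rewrite (cE v) big1 // => j jJ.
  suff -> : c v j = 0 by rewrite scale0r.
  by apply: contrapT => ?; apply: H; exists j.
(* The coordinates [c] come from choice; independence makes them unique, hence linear. *)
have cL : linear (fun u => c u j : k^o).
  move=> a u w; apply/eqP; rewrite -subr_eq0; apply/eqP.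
  apply: (indJ (fun j => c (a *: u + w) j - (a * c u j + c w j))) jJ.
  under eq_bigr do rewrite scalerBl scalerDl -scalerA.
  by rewrite sumrB big_split /= -scaler_sumr -!cE addrN.
pose l : {linear V -> k^o} :=
  HB.pack (fun u => c u j : k^o) (GRing.isLinear.Build k V k^o _ _ cL).
by exists l.
Qed.

End LinearAlgebra.

(** * Tensor products over k: calculus of pure tensors, functoriality, slices *)

Section TensorFacts.
Variable k : fieldType.
Implicit Types U V W : lmodType k.

Lemma tensDl U V (u u' : U) (v : V) : tens (u + u') v = tens u v + tens u' v.
Proof. by have := (tens_bilinear U V).1 v 1 u u'; rewrite /= !scale1r. Qed.

Lemma tensDr U V (u : U) (v v' : V) : tens u (v + v') = tens u v + tens u v'.
Proof. by have := (tens_bilinear U V).2 u 1 v v'; rewrite /= !scale1r. Qed.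

Lemma tens0l U V (v : V) : tens (0 : U) v = 0.
Proof. by apply: (addIr (tens 0 v)); rewrite -tensDl !add0r. Qed.

Lemma tens0r U V (u : U) : tens u (0 : V) = 0.
Proof. by apply: (addIr (tens u 0)); rewrite -tensDr !add0r. Qed.

Lemma tensZl U V c (u : U) (v : V) : tens (c *: u) v = c *: tens u v.
Proof.
by have := (tens_bilinear U V).1 v c u 0; rewrite /= tens0l !addr0.
Qed.

Lemma tensZr U V c (u : U) (v : V) : tens u (c *: v) = c *: tens u v.
Proof.
by have := (tens_bilinear U V).2 u c v 0; rewrite /= tens0r !addr0.
Qed.

Lemma tens_suml U V (I : Type) (r : seq I) (P : pred I) (u : I -> U) (v : V) :
  tens (\sum_(i <- r | P i) u i) v = \sum_(i <- r | P i) tens (u i) v.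
Proof.
exact: (big_morph (fun x => tens x v) (fun x y => tensDl x y v) (tens0l _ v)).
Qed.

Lemma tens_sumr U V (I : Type) (r : seq I) (P : pred I) (u : U) (v : I -> V) :
  tens u (\sum_(i <- r | P i) v i) = \sum_(i <- r | P i) tens u (v i).
Proof. exact: (big_morph (tens u) (tensDr u) (tens0r _ u)). Qed.

Lemma tensor_sum_tens U V (z : tensor U V) :
  exists n (u : 'I_n -> U) (v : 'I_n -> V), z = \sum_i tens (u i) (v i).
Proof.
suff [s ->] : exists s : seq (U * V), z = \sum_(p <- s) tens p.1 p.2.
  exists (size s), (fun i => (s`_i).1), (fun i => (s`_i).2).
  by rewrite (big_nth 0) big_mkord.
elim/tensor_ind: z => [u v|c _ _ [s ->] [t ->]].
  by exists [:: (u, v)]; rewrite big_seq1.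
exists ([seq (c *: p.1, p.2) | p <- s] ++ t).
rewrite big_cat big_map /= scaler_sumr; congr (_ + _).
by apply: eq_bigr => p _; rewrite tensZl.
Qed.

(** Pure tensors absorb scalars, so additivity suffices. This form of induction makes no reference
    to k-scaling and therefore suits the ring A (x) B and its modules. *)
Lemma tensor_add_ind U V (P : tensor U V -> Prop) :
    (forall u v, P (tens u v)) -> (forall s t, P s -> P t -> P (s + t)) ->
  forall t, P t.
Proof.
move=> Pt PD t; have [n [u [v ->]]] := tensor_sum_tens t.
(* The empty sum is covered as the pure tensor 0 (x) 0. *)
by apply: (big_ind P) => //; rewrite -(tens0l _ 0).
Qed.

Section Map.
Variables (U U' V V' : lmodType k).
Variables (f : {linear U -> U'}) (g : {linear V -> V'}).

Definition tensor_map : tensor U V -> tensor U' V' :=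
  tensor_lift (fun u v => tens (f u) (g v)).

Lemma tensor_map_bilinear :
  bilinear_for *:%R *:%R (fun u v => tens (f u) (g v)).
Proof.
by split=> [v c u u'|u c v v'];
   rewrite linearP ?(tensDl, tensDr) ?(tensZl, tensZr).
Qed.

Lemma tensor_mapE u v : tensor_map (tens u v) = tens (f u) (g v).
Proof. exact/tensor_liftE/tensor_map_bilinear. Qed.

HB.instance Definition _ := GRing.isLinear.Build k _ _ _ tensor_map
  (tensor_lift_linear tensor_map_bilinear).

End Map.

Section Slice.
Variables (U V : lmodType k) (l : {linear V -> k^o}).

(* id (x) l, followed by U (x) k = U *)
Definition slice : tensor U V -> U := tensor_lift (fun u v => l v *: u).

Lemma slice_bilinear : bilinear_for *:%R *:%R (fun (u : U) v => l v *: u).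
Proof.
split=> [v c u u'|u c v v'] /=; last by rewrite linearP scalerDl /= scalerA.
by rewrite scalerDr !scalerA mulrC.
Qed.

Lemma slice_tens u v : slice (tens u v) = l v *: u.
Proof. exact/tensor_liftE/slice_bilinear. Qed.

HB.instance Definition _ := GRing.isLinear.Build k _ _ _ slice
  (tensor_lift_linear slice_bilinear).

End Slice.

Lemma tens_neq0 U V (I : finType) (e : I -> V) (u : U) (v : V) :
  spans_family e -> u <> 0 -> v <> 0 -> tens u v <> 0.
Proof.
move=> spe u0 v0 uv0; have [l /eqP lv0] := linear_form_neq0 spe v0; apply: u0.
apply/eqP; have /eqP := slice_tens l u v; rewrite uv0 linear0 eq_sym.
by rewrite scaler_eq0 (negPf lv0).
Qed.

End TensorFacts.

(** * Tensors as sums with independent left factors *)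

Section FreeSum.
Variables (k : fieldType) (U V : lmodType k).

(** Rewrite the left factors of any presentation through an independent subfamily and collect the
    coefficients on the right. *)
Lemma tensor_free_sum (z : tensor U V) :
  exists (I : finType) (J : {set I}) (u : I -> U) (v : I -> V),
    z = \sum_(j in J) tens (u j) (v j) /\
    (forall c : I -> k, \sum_(j in J) c j *: u j = 0 ->
       forall j, j \in J -> c j = 0).
Proof.
have [n [u [v ->]]] := tensor_sum_tens z.
have [J [spanJ indJ]] := free_subfamily u; have /choice[c cE] i := spanJ i.
exists 'I_n, J, u, (fun j => \sum_i c i j *: v i); split=> //.
under [RHS]eq_bigr do rewrite tens_sumr.
rewrite exchange_big; apply: eq_bigr => i _ /=.
by rewrite {1}cE tens_suml; apply: eq_bigr => j _; rewrite tensZr -tensZl.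
Qed.

End FreeSum.

(** * Coordinates in a finite-dimensional right factor *)

Section Expansion.
Variables (k : fieldType) (B : vectType k).
Implicit Type U : lmodType k.

Definition vbase (j : 'I_(\dim {:B})) : B := (vbasis {:B})`_j.

Definition vcoord (j : 'I_(\dim {:B})) : {linear B -> k^o} :=
  coord (vbasis {:B}) j.

Lemma vcoordE (v : B) : v = \sum_j vcoord j v *: vbase j.
Proof. exact/coord_vbasis/memvf. Qed.

Lemma tensor_expand U (z : tensor U B) :
  z = \sum_j tens (slice (vcoord j) z) (vbase j).
Proof.
elim/tensor_ind: z => [u v|c s t IHs IHt].
  rewrite {1}[v]vcoordE tens_sumr; apply: eq_bigr => j _.
  by rewrite slice_tens tensZr tensZl.
rewrite {1}IHs {1}IHt scaler_sumr -big_split; apply: eq_bigr => j _.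
by rewrite linearP tensDl tensZl.
Qed.

Lemma slice_inj U (s t : tensor U B) :
  (forall l : {linear B -> k^o}, slice l s = slice l t) -> s = t.
Proof.
move=> st; rewrite [s]tensor_expand [t]tensor_expand.
by apply: eq_bigr => j _; rewrite st.
Qed.

Lemma slice_expand U (l : {linear B -> k^o}) (z : tensor U B) :
  slice l z = \sum_j l (vbase j) *: slice (vcoord j) z.
Proof.
rewrite {1}[z]tensor_expand linear_sum.
by apply: eq_bigr => j _; rewrite /= slice_tens.
Qed.

Lemma vector_form_sep (v : B) :
  (forall l : {linear B -> k^o}, l v = 0) -> v = 0.
Proof. by move=> lv; rewrite [v]vcoordE big1 // => j _; rewrite lv scale0r. Qed.

(** Slicing by a form [l] turns the identities, for all [p] at once, into a relation between the
    functions [f j] with coefficients [l (h j) - l (h' j)]. These vanish for every [l], and forms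
    separate the points of [B]. *)
Lemma tensor_free_coef (U : lmodType k) (P : Type) (I : finType)
    (J : {set I}) (f : I -> P -> U) (h h' : I -> B) :
    (forall c : I -> k, \sum_(j in J) c j *: f j = 0 ->
       forall j, j \in J -> c j = 0) ->
    (forall p, \sum_(j in J) tens (f j p) (h j)
       = \sum_(j in J) tens (f j p) (h' j)) ->
  forall j, j \in J -> h j = h' j.
Proof.
move=> indJ hh' j jJ; apply/eqP; rewrite -subr_eq0; apply/eqP.
apply: vector_form_sep => l; rewrite linearB.
apply: (indJ (fun j => l (h j) - l (h' j))) jJ; apply: funext => p.
have := congr1 (slice l) (hh' p); rewrite !linear_sum fct_sumE => E.
apply: (etrans (y := \sum_(i in J) (slice l (tens (f i p) (h i))
                                - slice l (tens (f i p) (h' i))))).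
  by apply: eq_bigr => i _; rewrite !slice_tens -scalerBl.
by rewrite sumrB E subrr.
Qed.

(* The coefficients g inherit from Gamma every property that can be phrased as
   an equality of sums of tensors against the family e. *)
Lemma tensor_decomposition (U : lmodType k) (P Q : Type) (I : finType)
    (e : I -> P -> U) (Gamma : P -> Q -> tensor U B) :
    (forall q, exists h : I -> B, forall p,
       Gamma p q = \sum_i tens (e i p) (h i)) ->
  exists (J : {set I}) (g : I -> Q -> B),
    (forall p q, Gamma p q = \sum_(j in J) tens (e j p) (g j q)) /\
    (forall h h' : I -> B,
       (forall p, \sum_(j in J) tens (e j p) (h j)
          = \sum_(j in J) tens (e j p) (h' j)) ->
       forall j, j \in J -> h j = h' j).
Proof.
move=> /choice[h hE]; have [J [spanJ indJ]] := free_subfamily e.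
have /choice[c cE] i := spanJ i.
exists J, (fun j q => \sum_i c i j *: h q i); split=> [p q|h1 h2]; last first.
  exact: tensor_free_coef indJ.
rewrite hE; under [RHS]eq_bigr do rewrite tens_sumr.
rewrite exchange_big; apply: eq_bigr => i _ /=.
rewrite [e i]cE fct_sumE tens_suml; apply: eq_bigr => j _.
by rewrite tensZr -tensZl.
Qed.

End Expansion.

(** * Elementwise criteria for torsionless and reflexive modules *)

Section Torsionless.
Variables (R : pzRingType) (M : lmodType R).

Lemma torsionlessP :
  torsionless M <-> forall m : M, (forall f : dual M, f m = 0) -> m = 0.
Proof.
split=> [inj m m0|sep m m' mm'].
  by apply: inj; apply: dualP => f /=; rewrite m0 linear0.
apply/eqP; rewrite -subr_eq0; apply/eqP; apply: sep => f.
by rewrite linearB /= -[f m]bidual_mapE mm' bidual_mapE subrr.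
Qed.

Lemma reflexiveP :
  reflexive_module M <->
    torsionless M /\
    forall G : dual (dual M), exists m : M, forall f : dual M, G f = f m.
Proof.
split=> [[h hK Kh]|[inj /choice[h hE]]].
  split=> [|G]; first exact: can_inj hK.
  exists (h G) => f.
  by rewrite -[LHS](congr1 (fun H : dual (dual M) => H f) (Kh G)).
have Kh : cancel h (@bidual_map R M).
  by move=> G; apply: dualP => f /=; rewrite hE.
by exists h => // m; apply: inj; rewrite Kh.
Qed.

End Torsionless.

(** * Pure tensors in A (x) B, in X (x) Y and in its dual *)

Section TensorModuleFacts.
Variables (k : fieldType) (A B : falgType k) (X : lmodType A) (Y : lmodType B).

(** [atens] and [mtens] are [tens] retyped, so that products and scalings are those of the ring A
    (x) B and its module rather than those of k-modules. *)
Definition atens (a : A) (b : B) : tensor_alg A B := tens a b.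
Definition mtens (x : X) (y : Y) : tensor_mod X Y :=
  tens (x : restrict_scalars X) (y : restrict_scalars Y).

Lemma atensM a b a' b' : atens a b * atens a' b' = atens (a * a') (b * b').
Proof. exact: tensor_alg_mulE. Qed.

Lemma atens_scale a b x y : atens a b *: mtens x y = mtens (a *: x) (b *: y).
Proof. exact: tensor_mod_scaleE. Qed.

Lemma mtensDl x x' y : mtens (x + x') y = mtens x y + mtens x' y.
Proof. exact: tensDl. Qed.

Lemma mtensDr x y y' : mtens x (y + y') = mtens x y + mtens x y'.
Proof. exact: tensDr. Qed.

Lemma mtensZl a x y : mtens (a *: x) y = atens a 1 *: mtens x y.
Proof. by rewrite atens_scale scale1r. Qed.

Lemma mtensZr b x y : mtens x (b *: y) = atens 1 b *: mtens x y.
Proof. by rewrite atens_scale scale1r. Qed.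

Lemma tensor_alg_ind (P : tensor_alg A B -> Prop) :
    (forall a b, P (atens a b)) -> (forall s t, P s -> P t -> P (s + t)) ->
  forall t, P t.
Proof. exact: (@tensor_add_ind k A B P). Qed.

Lemma tensor_mod_ind (P : tensor_mod X Y -> Prop) :
    (forall x y, P (mtens x y)) -> (forall s t, P s -> P t -> P (s + t)) ->
  forall t, P t.
Proof.
exact: (@tensor_add_ind k (restrict_scalars X) (restrict_scalars Y) P).
Qed.

Lemma dual_klinear (C : algType k) (Z : lmodType C) (f : dual Z) :
  linear (f : restrict_scalars Z -> C).
Proof.
move=> c x y; rewrite linearP; congr (_ + _).
by rewrite [LHS]/GRing.scale /= mulr_algl.
Qed.

Definition dual_kmap (C : algType k) (Z : lmodType C) (f : dual Z) :
    {linear restrict_scalars Z -> C} :=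
  HB.pack (f : restrict_scalars Z -> C)
    (GRing.isLinear.Build k (restrict_scalars Z) C _ _ (dual_klinear f)).

Definition dtens_fun (f : dual X) (g : dual Y) (z : tensor_mod X Y) :
    (tensor_alg A B)^o :=
  tensor_map (dual_kmap f) (dual_kmap g) z.

Lemma dtens_funE f g x y : dtens_fun f g (mtens x y) = atens (f x) (g y).
Proof. exact: tensor_mapE. Qed.

Lemma dtens_funD f g z z' :
  dtens_fun f g (z + z') = dtens_fun f g z + dtens_fun f g z'.
Proof. exact: linearD. Qed.

Lemma dtens_linear f g : linear (dtens_fun f g).
Proof.
move=> w z z'; rewrite dtens_funD; congr (_ + _).
rewrite [RHS]/GRing.scale /=.
elim/tensor_alg_ind: w => [a b|w w' IHw IHw']; last first.
  by rewrite scalerDl dtens_funD IHw IHw' mulrDl.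
elim/tensor_mod_ind: z => [x y|s t IHs IHt].
  by rewrite atens_scale !dtens_funE !linearZ /= atensM.
by rewrite scalerDr !dtens_funD IHs IHt mulrDr.
Qed.

Definition dtens (f : dual X) (g : dual Y) : dual (tensor_mod X Y) :=
  mk_dual (dtens_linear f g).

Lemma dtensE f g x y : dtens f g (mtens x y) = atens (f x) (g y).
Proof. exact: dtens_funE. Qed.

End TensorModuleFacts.

(** The products of basis vectors of [C] with module generators span over k. *)
Lemma finitely_generated_span (k : fieldType) (C : falgType k)
    (Z : lmodType C) :
  finitely_generated Z ->
  exists (I : finType) (e : I -> restrict_scalars Z), spans_family e.
Proof.
move=> [s sE]; exists ('I_(size s) * 'I_(\dim {:C}))%type.
exists (fun p : 'I_(size s) * 'I_(\dim {:C}) => vbase p.2 *: (s`_p.1 : Z)) => z.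
have [c ->] := sE z; exists (fun p => vcoord p.2 (c p.1)).
transitivity (\sum_i \sum_j
  (vcoord j (c i) : k) *: (vbase j *: (s`_i : Z) : restrict_scalars Z));
  last by rewrite pair_big.
apply: eq_bigr => i _; rewrite {1}[c i]vcoordE scaler_suml.
by apply: eq_bigr => j _; rewrite [RHS]scalerA mulr_algl.
Qed.

(** * Slices of A (x) B and their compatibility with multiplication *)

Section AlgebraSlice.
Variables (k : fieldType) (A B : falgType k).

Lemma form_mulr_linear (l : {linear B -> k^o}) (b : B) :
  linear (fun b' => l (b' * b) : k^o).
Proof. by move=> c x y; rewrite mulrDl -scalerAl linearP. Qed.

(** Right multiplication by b, moved from the tensor to the form: this is how slices meet the right
    scalars acting on duals ([aslice_mulr]). *)
Definition form_mulr (l : {linear B -> k^o}) (b : B) : {linear B -> k^o} :=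
  HB.pack (fun b' => l (b' * b) : k^o)
    (GRing.isLinear.Build k B k^o _ _ (form_mulr_linear l b)).

Definition aslice (l : {linear B -> k^o}) (w : tensor_alg A B) : A := slice l w.

Lemma aslice_atens l a b : aslice l (atens a b) = l b *: a.
Proof. exact: slice_tens. Qed.

Lemma asliceD l w w' : aslice l (w + w') = aslice l w + aslice l w'.
Proof. exact: linearD. Qed.

Lemma aslice_mull l a w : aslice l (atens a 1 * w) = a * aslice l w.
Proof.
elim/tensor_alg_ind: w => [a' b'|s t IHs IHt].
  by rewrite atensM mul1r !aslice_atens scalerAr.
by rewrite mulrDr !asliceD mulrDr IHs IHt.
Qed.

Lemma aslice_mulr l w a b :
  aslice l (w * atens a b) = aslice (form_mulr l b) w * a.
Proof.
elim/tensor_alg_ind: w => [a' b'|s t IHs IHt].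
  by rewrite atensM !aslice_atens scalerAl.
by rewrite mulrDl !asliceD mulrDl IHs IHt.
Qed.

Lemma aslice_inj w w' : (forall l, aslice l w = aslice l w') -> w = w'.
Proof. exact: slice_inj. Qed.

End AlgebraSlice.

(** * Torsionlessness of X (x) Y and of its left factor *)

Section TorsionlessTensor.
Variables (k : fieldType) (A B : falgType k) (X : lmodType A) (Y : lmodType B).

(** Write z as a sum of u_j (x) v_j with independent u_j. Slicing (f (x) g)(z) = 0 by [l] shows that
    every f kills the sum of the l(g v_j) u_j. So this sum is 0, each l(g v_j) vanishes, and v_j = 0
    because l and g are arbitrary. *)
Lemma torsionless_tensor :
  torsionless X -> torsionless Y -> torsionless (tensor_mod X Y).
Proof.
move=> /torsionlessP sepX /torsionlessP sepY; apply/torsionlessP => z z0.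
have [I [J [u [v [zE indJ]]]]] :=
  @tensor_free_sum k (restrict_scalars X) (restrict_scalars Y) z.
rewrite zE big1 // => j jJ; suff -> : v j = 0 by exact: tens0r.
apply: sepY => g; apply: vector_form_sep => l.
apply: (indJ (fun j => l (g (v j)))) jJ; apply: sepX => f.
have := congr1 (@aslice _ A B l) (z0 (dtens f g)).
rewrite zE -[dtens f g _]/(tensor_map (dual_kmap f) (dual_kmap g) _).
rewrite [aslice l 0](linear0 (slice (U := A) l)) => <-.
rewrite -[LHS]/(dual_kmap f _) /aslice linear_sum.
rewrite (linear_sum (tensor_map (dual_kmap f) (dual_kmap g))) linear_sum.
by apply: eq_bigr => i _; rewrite /= tensor_mapE slice_tens linearZ;
  exact: (mulr_algl _ (f _ : A)).
Qed.

Lemma slice_at_linear (F : dual (tensor_mod X Y)) l (y : Y) :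
  linear (fun x : X => aslice l (F (mtens x y)) : A^o).
Proof.
move=> a x x'; rewrite mtensDl mtensZl linearP asliceD; congr (_ + _).
exact: aslice_mull.
Qed.

Definition slice_at F l y : dual X := mk_dual (slice_at_linear F l y).

Lemma slice_atE F l y x : slice_at F l y x = aslice l (F (mtens x y)).
Proof. by []. Qed.

(** Fix y <> 0. If every dual element kills x, so do the slices [slice_at F l y]; hence every F
    kills x (x) y, so x (x) y = 0. For x <> 0 this contradicts [tens_neq0], whose spanning family
    for Y comes from finite generation. *)
Lemma tensor_torsionless_l :
    finitely_generated Y -> (exists y : Y, y <> 0) ->
  torsionless (tensor_mod X Y) -> torsionless X.
Proof.
move=> /finitely_generated_span[I [e spe]] [y y0] /torsionlessP sep.
apply/torsionlessP => x x0; apply: contrapT => x_neq0.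
apply: (@tens_neq0 k (restrict_scalars X) _ I e x y spe x_neq0 y0).
apply: sep => F; apply: aslice_inj => l.
by rewrite -[LHS](slice_atE F l y x) x0 [RHS](linear0 (slice (U := A) l)).
Qed.

End TorsionlessTensor.

Lemma dual_sumE (R : pzRingType) (M : lmodType R) (I : Type) (r : seq I)
    (P : pred I) (f : I -> dual M) (m : M) :
  (\sum_(i <- r | P i) f i) m = \sum_(i <- r | P i) f i m.
Proof. by apply: (big_morph (fun g : dual M => g m)). Qed.

Lemma dual_addE (R : pzRingType) (M : lmodType R) (f g : dual M) (m : M) :
  (f + g) m = f m + g m.
Proof. by []. Qed.

Lemma dual_scaleE (R : pzRingType) (M : lmodType R) (a : R^c)
    (f : dual M) (m : M) :
  (a *: f) m = (f m : R) * (a : R).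
Proof. by []. Qed.

Lemma bidual_linearZ (R : pzRingType) (M : lmodType R) (phi : dual (dual M))
    (a : R^c) (f : dual M) :
  phi (a *: f) = (phi f : R) * (a : R).
Proof. by rewrite linearZ. Qed.

(** * The dual of X (x) Y is spanned by the f (x) g *)

Section DualTensor.
Variables (k : fieldType) (A B : falgType k) (X : lmodType A) (Y : lmodType B).
Local Notation M := (tensor_mod X Y).

Lemma dtensD_l (f f' : dual X) (g : dual Y) :
  dtens (f + f') g = dtens f g + dtens f' g.
Proof.
apply: dualP; elim/tensor_mod_ind => [x y|s t IHs IHt].
  by rewrite dual_addE !dtensE; apply: tensDl.
by rewrite !linearD IHs IHt.
Qed.

Lemma dtensD_r (f : dual X) (g g' : dual Y) :
  dtens f (g + g') = dtens f g + dtens f g'.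
Proof.
apply: dualP; elim/tensor_mod_ind => [x y|s t IHs IHt].
  by rewrite dual_addE !dtensE; apply: tensDr.
by rewrite !linearD IHs IHt.
Qed.

Lemma dtensZ (a : A^c) (b : B^c) (f : dual X) (g : dual Y) :
  dtens (a *: f) (b *: g)
    = (atens (a : A) (b : B) : (tensor_alg A B)^c) *: dtens f g.
Proof.
apply: dualP; elim/tensor_mod_ind => [x y|s t IHs IHt].
  by rewrite dual_scaleE !dtensE atensM.
by rewrite !linearD IHs IHt.
Qed.

Lemma tensor_alg_expand (w : tensor_alg A B) :
  w = \sum_j atens (aslice (vcoord j) w) (vbase j).
Proof. exact: tensor_expand. Qed.

Lemma atens_mul1l (b : B) (a : A) (b' : B) :
  atens 1 b * atens a b' = atens a (b * b').
Proof. by rewrite atensM mul1r. Qed.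

(** Writing y through the generators s_i expresses F(x (x) y) by the finitely many slices of the
    maps x |-> F(x (x) s_i), with coefficients in B that depend on y only. [tensor_decomposition]
    then selects independent slices. *)
Lemma dual_tensor_span (F : dual M) : finitely_generated Y ->
  exists (I : finType) (J : {set I}) (f : I -> dual X) (g : I -> dual Y),
    F = \sum_(j in J) dtens (f j) (g j).
Proof.
move=> [s sE]; pose I : finType := ('I_(\dim {:B}) * 'I_(size s))%type.
pose f (i : I) : dual X := slice_at F (vcoord i.1) s`_i.2.
have FE y : exists h : I -> B, forall x : X,
    (F (mtens x y) : tensor A B) = \sum_i tens (f i x : A) (h i).
  have [b ->] := sE y; exists (fun i => b i.2 * vbase i.1) => x.
  rewrite -(pair_big xpredT xpredT (fun j i =>
    tens (f (j, i) x : A) (b i * vbase j))) exchange_big /=.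
  rewrite [mtens x _](big_morph (mtens x) (id1 := 0) (op1 := +%R) (mtensDr x)).
    rewrite linear_sum; apply: eq_bigr => i _.
    rewrite mtensZr linearZ /= {1}[F _]tensor_alg_expand [LHS]mulr_sumr.
    by apply: eq_bigr => j _; apply: atens_mul1l.
  exact: tens0r.
have [J [g [gE freeJ]]] := tensor_decomposition (e := fun i x => f i x : A) FE.
(* Uniqueness of coefficients holds on [J] only; outside it the zero form is a default. *)
have /choice[h hE] j : exists h : dual Y, j \in J -> h =1 g j.
  have [jJ|_] := boolP (j \in J); last by exists 0.
  suff gL : linear (g j : Y -> B^o) by exists (mk_dual gL).
  move=> b y y'.
  (* By linearity of F, both coefficient families represent F at x (x) (b y + y'), so they agree on
     [J]. *)
  apply: (freeJ (g^~ (b *: y + y')) (fun j => b * g j y + g j y')) jJ => x.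
  rewrite -gE mtensDr mtensZr linearP !gE [_ *: _]mulr_sumr -big_split /=.
  apply: eq_bigr => i _; rewrite tensDr; congr (_ + _); exact: atens_mul1l.
exists I, J, f, h; apply: dualP; elim/tensor_mod_ind => [x y|t t' IHt IHt'].
  rewrite gE dual_sumE; apply: eq_bigr => j jJ.
  by rewrite dtensE /atens hE.
by rewrite !linearD IHt IHt'.
Qed.

End DualTensor.

(** * Reflexivity of X (x) Y and of its left factor *)

Section ReflexiveTensor.
Variables (k : fieldType) (A B : falgType k) (X : lmodType A) (Y : lmodType B).
Local Notation M := (tensor_mod X Y).

Lemma aslice_mulrl l (w : tensor_alg A B) a :
  aslice l (w * atens a 1) = aslice l w * a.
Proof.
rewrite aslice_mulr; congr (_ * _); rewrite /aslice 2!slice_expand.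
by apply: eq_bigr => j _; rewrite /= mulr1.
Qed.

Lemma bidual_slice_linear (G : dual (dual M)) l (g : dual Y) :
  linear (fun f : dual X => aslice l (G (dtens f g)) : A^c^o).
Proof.
move=> a f f'; rewrite dtensD_l -{1}[g]scale1r dtensZ linearP asliceD.
by congr (_ + _); apply: aslice_mulrl.
Qed.

(** For fixed g, the slices of f |-> G(f (x) g) lie in X^** and so are evaluations. Expanding their
    points over a k-spanning family e of X leaves evaluations at the e_i, a family that does not
    depend on g. Its coefficients, as functions of g, lie in Y^** and are evaluations at points
    y_j. *)
Lemma reflexive_tensor :
    finitely_generated X -> finitely_generated Y ->
  reflexive_module X -> reflexive_module Y -> reflexive_module M.
Proof.
move=> fgX fgY /reflexiveP[tX rX] /reflexiveP[tY rY]; apply/reflexiveP.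
split=> [|G]; first exact: torsionless_tensor.
have [I [e spe]] := finitely_generated_span fgX.
have GE (g : dual Y) : exists h : I -> B, forall f : dual X,
    (G (dtens f g) : tensor A B) = \sum_i tens (f (e i) : A) (h i).
  have /choice[x xE] j : exists x : X, forall f : dual X,
      aslice (vcoord j) (G (dtens f g)) = f x.
    exact: rX (mk_dual (bidual_slice_linear G (vcoord j) g)).
  have /choice[c cE] j := spe (x j).
  exists (fun i => \sum_j c j i *: vbase j) => f.
  under [RHS]eq_bigr do rewrite tens_sumr.
  rewrite exchange_big {1}[LHS]tensor_alg_expand; apply: eq_bigr => j _ /=.
  rewrite xE {1}cE -[f _]/(dual_kmap f _) linear_sum /atens tens_suml.
  by apply: eq_bigr => i _; rewrite linearZ tensZr tensZl.
have [J [g [gE freeJ]]] :=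
  tensor_decomposition (e := fun i (f : dual X) => f (e i) : A) GE.
(* As before, linearity is available on [J] only, and 0 is the default elsewhere. *)
have /choice[y yE] j : exists y : Y, j \in J -> forall f : dual Y, g j f = f y.
  have [jJ|_] := boolP (j \in J); last by exists 0.
  suff gL : linear (g j : dual Y -> B^c^o).
    by have [y yE] := rY (mk_dual gL); exists y => _ f; rewrite -yE.
  move=> b q q'.
  apply: (freeJ (g^~ (b *: q + q')) (fun j => g j q * (b : B) + g j q')) jJ
    => f.
  rewrite -gE dtensD_r -{1}[f]scale1r dtensZ linearP !gE.
  rewrite [_ *: _]mulr_suml -big_split /=.
  apply: eq_bigr => i _; rewrite tensDr; congr (_ + _).
  rewrite -[LHS]/(atens _ _ * atens 1 (b : B)) atensM.
  by rewrite mulr1.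
(* It suffices to test this point on the f (x) h, which span the dual. *)
exists (\sum_(j in J) mtens (e j) (y j)) => F.
have [I' [J' [f [h ->]]]] := dual_tensor_span F fgY.
rewrite linear_sum dual_sumE; apply: eq_bigr => i _.
rewrite gE linear_sum; apply: eq_bigr => j jJ.
by rewrite dtensE yE.
Qed.

Lemma slice_atD (F F' : dual M) l y :
  slice_at (F + F') l y = slice_at F l y + slice_at F' l y.
Proof. by apply: dualP => x; rewrite slice_atE asliceD. Qed.

Lemma slice_atZ (a : A) (b : B) (F : dual M) l y :
  slice_at ((atens a b : (tensor_alg A B)^c) *: F) l y
    = (a : A^c) *: slice_at F (form_mulr l b) y.
Proof. by apply: dualP => x; rewrite slice_atE; apply: aslice_mulr. Qed.

Section Extension.
Variables (phi : dual (dual X)) (y : Y).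

(* phi (x) ev_y *)
Definition extension_fun (F : dual M) : (tensor_alg A B)^c^o :=
  \sum_j atens (phi (slice_at F (vcoord j) y)) (vbase j).

(** The definition involves the coordinate forms only. A general [l] is a k-combination of them, and
    the scalars pass through [phi] as right scalars from A. Since slices separate points, this
    formula determines the extension. *)
Lemma aslice_extension l F :
  aslice l (extension_fun F) = phi (slice_at F l y).
Proof.
have -> : slice_at F l y
    = \sum_j ((l (vbase j))%:A : A^c) *: slice_at F (vcoord j) y.
  apply: dualP => x; rewrite slice_atE /aslice slice_expand dual_sumE.
  by apply: eq_bigr => j _; rewrite dual_scaleE mulr_algr.
rewrite /aslice /extension_fun linear_sum linear_sum; apply: eq_bigr => j _.
by rewrite bidual_linearZ mulr_algr; apply: slice_tens.
Qed.

Lemma extension_linear : linear extension_fun.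
Proof.
have extD F F' : extension_fun (F + F') = extension_fun F + extension_fun F'.
  apply: aslice_inj => l.
  by rewrite asliceD !aslice_extension slice_atD linearD.
move=> w F F'; rewrite extD; congr (_ + _).
rewrite -[RHS]/((extension_fun F : tensor_alg A B) * (w : tensor_alg A B)).
elim/tensor_alg_ind: w => [a b|s t IHs IHt].
  (* After slicing, b is absorbed by the form and a remains as a right scalar, which [phi]
     respects. *)
  apply: aslice_inj => l; rewrite aslice_mulr !aslice_extension slice_atZ.
  exact: bidual_linearZ.
by rewrite scalerDl extD IHs IHt mulrDr.
Qed.

Definition extension : dual (dual M) := mk_dual extension_linear.

Lemma extension_dtens f g : extension (dtens f g) = atens (phi f) (g y).
Proof.
apply: aslice_inj => l; rewrite [LHS]aslice_extension aslice_atens.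
have -> : slice_at (dtens f g) l y = ((l (g y))%:A : A^c) *: f.
  apply: dualP => x.
  by rewrite slice_atE dtensE aslice_atens dual_scaleE mulr_algr.
by rewrite bidual_linearZ mulr_algr.
Qed.

End Extension.

Lemma aslice_dtens l (f : dual X) (g : dual Y) (z : M) :
  aslice l (dtens f g z) = f (slice (l \o dual_kmap g) z).
Proof.
elim/tensor_mod_ind: z => [x y|s t IHs IHt].
  rewrite dtensE aslice_atens /mtens slice_tens /=.
  by rewrite -[f (_ *: _)]/(dual_kmap f _) linearZ.
by rewrite linearD asliceD IHs IHt [slice _ (s + t)]linearD linearD.
Qed.

Lemma tensor_reflexive_l :
    (exists y : Y, y <> 0) -> torsionless X -> torsionless Y ->
  reflexive_module M -> reflexive_module X.
Proof.
move=> [y y0] tX /torsionlessP sepY /reflexiveP[_ rM].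
apply/reflexiveP; split=> // phi.
(* Torsionlessness of Y yields g with g y <> 0, and then a form that detects g y. *)
have [g [l lgy]] : exists (g : dual Y) (l : {linear B -> k^o}), l (g y) <> 0.
  apply: contrapT => H; apply/y0/sepY => g; apply: vector_form_sep => l.
  by apply: contrapT => lgy; apply: H; exists g, l.
have [z zE] := rM (extension phi y).
(* Evaluating at f (x) g and slicing by [l] gives l(g y) phi(f) = f applied to the slice of z by l o
   g; divide by l(g y). *)
exists ((l (g y) : k)^-1 *: slice (l \o dual_kmap g) z) => f.
rewrite -[RHS]/(dual_kmap f _) linearZ [dual_kmap f _]/=.
rewrite -aslice_dtens -zE extension_dtens aslice_atens /= scalerA mulVf.
  by rewrite scale1r.
exact/eqP.
Qed.

End ReflexiveTensor.

(** * Transport of duals and of both properties along semilinear isomorphisms *)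

Section SemilinearPush.
Variables (R R' : pzRingType) (M : lmodType R) (M' : lmodType R').
Variables (s : R -> R') (s' : R' -> R) (t' : M' -> M).
Hypotheses (sD : {morph s : x y / x + y}) (sM : {morph s : x y / x * y}).
Hypotheses (s'K : cancel s' s).
Hypothesis t'D : {morph t' : x y / x + y}.
Hypothesis t'Z : forall a m, t' (a *: m) = s' a *: t' m.

Lemma dual_push_linear (f : dual M) : linear (fun m => s (f (t' m)) : R'^o).
Proof. by move=> a m n; rewrite t'D t'Z linearP sD [X in X + _]sM s'K. Qed.

(** The swap changes the base ring from A (x) B to B (x) A, so duals are transported by conjugating
    with a ring isomorphism as well as a module isomorphism. *)
Definition dual_push (f : dual M) : dual M' := mk_dual (dual_push_linear f).

Lemma dual_pushP (a : R) (f g : dual M) :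
  dual_push ((a : R^c) *: f + g) = (s a : R'^c) *: dual_push f + dual_push g.
Proof. by apply: dualP => m /=; rewrite sD sM. Qed.

End SemilinearPush.

Section SemilinearIso.
Variables (R R' : pzRingType) (M : lmodType R) (M' : lmodType R').
Variables (s : R -> R') (s' : R' -> R) (t : M -> M') (t' : M' -> M).
Hypotheses (sD : {morph s : x y / x + y}) (sM : {morph s : x y / x * y}).
Hypotheses (s'D : {morph s' : x y / x + y}) (s'M : {morph s' : x y / x * y}).
Hypotheses (sK : cancel s s') (s'K : cancel s' s).
Hypotheses (tK : cancel t t') (t'K : cancel t' t).
Hypothesis tD : {morph t : x y / x + y}.
Hypothesis tZ : forall a m, t (a *: m) = s a *: t m.
Hypothesis t'D : {morph t' : x y / x + y}.
Hypothesis t'Z : forall a m, t' (a *: m) = s' a *: t' m.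

Let push : dual M -> dual M' := dual_push sD sM s'K t'D t'Z.
Let pull : dual M' -> dual M := dual_push s'D s'M sK tD tZ.

Lemma torsionless_semilinear_iso : torsionless M -> torsionless M'.
Proof.
move=> /torsionlessP sep; apply/torsionlessP => m m0.
have s'0 : s' 0 = 0 by apply: (addIr (s' 0)); rewrite -s'D !add0r.
have t0 : t 0 = 0 by apply: (addIr (t 0)); rewrite -tD !add0r.
rewrite -[m]t'K [t' m]sep // => f; rewrite -[LHS]sK.
by rewrite -[LHS]/(s' (push f m)) m0 s'0.
Qed.

Lemma reflexive_semilinear_iso : reflexive_module M -> reflexive_module M'.
Proof.
move=> /reflexiveP[tM rM]; apply/reflexiveP.
split=> [|G]; first exact: torsionless_semilinear_iso.
(* Transport G back to the bidual of M; the point representing it there is mapped forward by [t]. *)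
have GL : linear (fun f => s' (G (push f)) : R^c^o).
  by move=> a f g; rewrite /push dual_pushP linearP s'D [X in X + _]s'M sK.
have [m mE] := rM (mk_dual GL); exists (t m) => f.
have -> : f = push (pull f) by apply: dualP => n; rewrite /= s'K t'K.
apply: (can_inj s'K); rewrite -[LHS]/(mk_dual GL (pull f)) mE.
by rewrite /= s'K tK.
Qed.

End SemilinearIso.

(** * The swap isomorphism between X (x) Y and Y (x) X *)

Section Swap.
Variable k : fieldType.

Section TensorSwap.
Variables U V : lmodType k.

Definition tensor_swap : tensor U V -> tensor V U :=
  tensor_lift (fun u v => tens v u).

Lemma tensor_swap_bilinear :
  bilinear_for *:%R *:%R (fun (u : U) (v : V) => tens v u).
Proof.
by split=> [v c u u'|u c v v'] /=;
   rewrite ?(tensDl, tensDr) ?(tensZl, tensZr).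
Qed.

Lemma tensor_swapE u v : tensor_swap (tens u v) = tens v u.
Proof. exact/tensor_liftE/tensor_swap_bilinear. Qed.

Lemma tensor_swapD : {morph tensor_swap : x y / x + y}.
Proof.
move=> x y; have := tensor_lift_linear tensor_swap_bilinear 1 x y.
by rewrite /= !scale1r.
Qed.

End TensorSwap.

Lemma tensor_swapK U V : cancel (@tensor_swap U V) (@tensor_swap V U).
Proof.
elim/tensor_add_ind => [u v|s t IHs IHt]; first by rewrite !tensor_swapE.
by rewrite !tensor_swapD IHs IHt.
Qed.

Section AlgebraSwap.
Variables A B : falgType k.

Definition tensor_alg_swap : tensor_alg A B -> tensor_alg B A :=
  @tensor_swap A B.

Lemma tensor_alg_swapE a b : tensor_alg_swap (atens a b) = atens b a.
Proof. exact: tensor_swapE. Qed.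

Lemma tensor_alg_swapD : {morph tensor_alg_swap : x y / x + y}.
Proof. exact: tensor_swapD. Qed.

Lemma tensor_alg_swapM : {morph tensor_alg_swap : x y / x * y}.
Proof.
elim/tensor_alg_ind=> [a b|s t IHs IHt] y; last first.
  by rewrite mulrDl !tensor_alg_swapD IHs IHt mulrDl.
elim/tensor_alg_ind: y => [a' b'|s t IHs IHt]; last first.
  by rewrite mulrDr !tensor_alg_swapD IHs IHt mulrDr.
by rewrite atensM !tensor_alg_swapE atensM.
Qed.

End AlgebraSwap.

Lemma tensor_alg_swapK A B :
  cancel (@tensor_alg_swap A B) (@tensor_alg_swap B A).
Proof. exact: tensor_swapK. Qed.

Section ModuleSwap.
Variables (A B : falgType k) (X : lmodType A) (Y : lmodType B).

Definition tensor_mod_swap : tensor_mod X Y -> tensor_mod Y X :=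
  @tensor_swap (restrict_scalars X) (restrict_scalars Y).

Lemma tensor_mod_swapE x y : tensor_mod_swap (mtens x y) = mtens y x.
Proof. exact: tensor_swapE. Qed.

Lemma tensor_mod_swapD : {morph tensor_mod_swap : z z' / z + z'}.
Proof. exact: tensor_swapD. Qed.

Lemma tensor_mod_swapZ w z :
  tensor_mod_swap (w *: z) = tensor_alg_swap w *: tensor_mod_swap z.
Proof.
elim/tensor_alg_ind: w => [a b|s t IHs IHt]; last first.
  by rewrite tensor_alg_swapD !scalerDl tensor_mod_swapD IHs IHt.
elim/tensor_mod_ind: z => [x y|s t IHs IHt]; last first.
  by rewrite scalerDr !tensor_mod_swapD IHs IHt scalerDr.
by rewrite tensor_alg_swapE tensor_mod_swapE !atens_scale tensor_mod_swapE.
Qed.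

End ModuleSwap.

Variables (A B : falgType k) (X : lmodType A) (Y : lmodType B).

Lemma tensor_mod_swapK :
  cancel (@tensor_mod_swap A B X Y) (@tensor_mod_swap B A Y X).
Proof. exact: tensor_swapK. Qed.

End Swap.

Section SwapInvariance.
Variables (k : fieldType) (A B : falgType k) (X : lmodType A) (Y : lmodType B).

Lemma torsionless_swap :
  torsionless (tensor_mod X Y) -> torsionless (tensor_mod Y X).
Proof.
exact: (torsionless_semilinear_iso
  (@tensor_alg_swapD k A B) (@tensor_alg_swapM k A B) (@tensor_alg_swapD k B A)
  (@tensor_alg_swapK k A B) (@tensor_alg_swapK k B A)
  (@tensor_mod_swapK k B A Y X)
  (@tensor_mod_swapD k A B X Y) (@tensor_mod_swapD k B A Y X)
  (@tensor_mod_swapZ k B A Y X)).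
Qed.

Lemma reflexive_swap :
  reflexive_module (tensor_mod X Y) -> reflexive_module (tensor_mod Y X).
Proof.
exact: (reflexive_semilinear_iso
  (@tensor_alg_swapD k A B) (@tensor_alg_swapM k A B)
  (@tensor_alg_swapD k B A) (@tensor_alg_swapM k B A)
  (@tensor_alg_swapK k A B) (@tensor_alg_swapK k B A)
  (@tensor_mod_swapK k A B X Y) (@tensor_mod_swapK k B A Y X)
  (@tensor_mod_swapD k A B X Y) (@tensor_mod_swapZ k A B X Y)
  (@tensor_mod_swapD k B A Y X) (@tensor_mod_swapZ k B A Y X)).
Qed.

End SwapInvariance.

Theorem theorem1p1 (k : fieldType) (A B : falgType k)
    (X : lmodType A) (Y : lmodType B)
    (X_fg : finitely_generated X) (X_neq0 : exists x : X, x <> 0%R)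
    (Y_fg : finitely_generated Y) (Y_neq0 : exists y : Y, y <> 0%R) :
  (torsionless (tensor_mod X Y) <-> torsionless X /\ torsionless Y) /\
  (reflexive_module (tensor_mod X Y) <->
     reflexive_module X /\ reflexive_module Y).
Proof.
have tXY : torsionless (tensor_mod X Y) -> torsionless X /\ torsionless Y.
  split; first exact: tensor_torsionless_l Y_fg Y_neq0 _.
  by apply: (tensor_torsionless_l (Y := X)) => //; apply: torsionless_swap.
split; first by split=> // -[tX tY]; apply: torsionless_tensor.
split=> [rXY|[rX rY]]; last exact: reflexive_tensor.
(* Reflexivity of X (x) Y contains torsionlessness, so part (1) makes both factors torsionless, as
   [tensor_reflexive_l] requires. *)
have [tX tY] := tXY ((reflexiveP _).1 rXY).1.
split; first exact: tensor_reflexive_l rXY.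
by apply: (tensor_reflexive_l (Y := X)) (reflexive_swap rXY).
Qed.
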